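(* Let $n\ge 1$ be axial, i.e. such that there is at least one self-conjugate partition of $n$. Then: (1) the self-conjugate axis $\mathrm{Ax}_n=\{\lambda\vdash n:\lambda=\lambda'\}$ is the fixed-point set of the conjugation involution $\lambda\mapsto\lambda'$ on the partition graph $G_n$; (2) the induced subgraph $G_n[\mathrm{Ax}_n]$ is edgeless; (3) the thin spine $\mathrm{Sp}_n=\mathrm{Ax}_n\cup\bigcup_{\{\alpha,\beta\}\in E(\mathcal A_n)}M(\alpha,\beta)$ is a canonical conjugation-invariant induced subgraph of $G_n$; (4) $\mathrm{Ax}_n\subseteq \mathrm{Sp}_n\subseteq C_n^{(1)}$.
   Context: Partition graph: $G_n$ is the simple graph whose vertices are the partitions of $n$, written $\lambda=(\lambda_1\ge\dots\ge\lambda_\ell\ge1)$. Two distinct partitions $\lambda,\mu$ of $n$ are adjacent if $\mu$ is obtained from $\lambda$ by an elementary transfer: decrease one part of $\lambda$ by $1$, increase a different part by $1$ (the receiving part may be a newly adjoined zero part), delete a zero part if necessary, and reorder into nonincreasing form. $N_{G_n}(\alpha)$ is the set of neighbors of $\alpha$ and $d_{G_n}$ is graph distance. $\lambda'$ is the conjugate partition of $\lambda$; conjugation is an involutive automorphism of $G_n$. Axis: $\mathrm{Ax}_n=\{\lambda\vdash n:\lambda=\lambda'\}$; $n$ is axial if $\mathrm{Ax}_n\ne\varnothing$. Central regions: $C_n^{(r)}=\{\lambda\in V(G_n): d_{G_n}(\lambda,\mathrm{Ax}_n)\le r\}$, where $d_{G_n}(\lambda,S)=\min_{\alpha\in S}d_{G_n}(\lambda,\alpha)$.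 Axial interaction graph: $\mathcal A_n$ has vertex set $\mathrm{Ax}_n$, and distinct $\alpha,\beta\in\mathrm{Ax}_n$ are adjacent in $\mathcal A_n$ iff $N_{G_n}(\alpha)\cap N_{G_n}(\beta)\ne\varnothing$. For such a pair, the set of mediators is $M(\alpha,\beta)=N_{G_n}(\alpha)\cap N_{G_n}(\beta)$. Thin spine: $\mathrm{Sp}_n$ denotes both the vertex set $\mathrm{Ax}_n\cup\bigcup_{\{\alpha,\beta\}\in E(\mathcal A_n)}M(\alpha,\beta)$ and the subgraph of $G_n$ induced on it. ''Canonical'' means determined by the graph $G_n$ together with the conjugation involution, without auxiliary choices. ''Conjugation-invariant'' means mapped to itself by $\lambda\mapsto\lambda'$. *)

(* Defs.v *)
From HB Require Import structures.
From mathcomp Require Import all_boot.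

Set Implicit Arguments.
Unset Strict Implicit.
Unset Printing Implicit Defensive.

Record sgraph := SGraph {
  vertex :> finType;
  adj : rel vertex;
  adj_sym : symmetric adj;
  adj_irrefl : irreflexive adj
}.

Section Graph.
Variable G : sgraph.
Implicit Types (x y : G) (S : {set G}).

Definition nbhd x : {set G} := [set y | adj x y].

Definition walk (k : nat) x y : bool :=
  [exists p : k.-tuple G, path (@adj G) x p && (last x p == y)].

(* A shortest walk has length less than #|G|; hence the value #|G| is taken
   exactly when there is no walk from x to y, and plays the role of infinity. *)
Definition gdist x y : nat := find (fun k => walk k x y) (iota 0 #|G|).

Definition gdist_set x S : nat := \big[minn/#|G|]_(y in S) gdist x y.

Record subgraph := Subgraph {
  sverts : {set G};
  sadj : rel G;
  sadj_sym : symmetric sadj;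
  sadj_sub : forall x y,
    sadj x y -> [&& x \in sverts, y \in sverts & adj x y]
}.

Definition induced_adj S : rel G :=
  fun x y => [&& x \in S, y \in S & adj x y].

Fact induced_adj_sym S : symmetric (induced_adj S).
Proof. by move=> x y; rewrite /induced_adj adj_sym andbCA. Qed.

Definition induced S : subgraph :=
  @Subgraph S (induced_adj S) (@induced_adj_sym S) (fun _ _ h => h).

Definition is_induced (A : subgraph) : Prop :=
  {in sverts A &, forall x y, sadj A x y = adj x y}.

Definition edgeless (A : subgraph) : Prop := forall x y, ~~ sadj A x y.

Definition mediators x y : {set G} := nbhd x :&: nbhd y.

Definition interaction_adj S : rel {x : G | x \in S} :=
  fun a b => (a != b) && (mediators (val a) (val b) != set0).

Fact interaction_adj_sym S : symmetric (@interaction_adj S).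
Proof. by move=> a b; rewrite /interaction_adj eq_sym /mediators setIC. Qed.

Fact interaction_adj_irrefl S : irreflexive (@interaction_adj S).
Proof. by move=> a; rewrite /interaction_adj eqxx. Qed.

Definition interaction_graph S : sgraph :=
  SGraph (@interaction_adj_sym S) (@interaction_adj_irrefl S).

Definition spine_set S : {set G} :=
  S :|: \bigcup_(e : interaction_graph S * interaction_graph S | adj e.1 e.2)
          mediators (val e.1) (val e.2).

End Graph.

Definition automorphism (G : sgraph) (f : G -> G) : Prop :=
  bijective f /\ {mono f : x y / adj x y}.

Definition maps_onto (G H : sgraph) (f : G -> H)
    (A : subgraph G) (B : subgraph H) : Prop :=
  f @: sverts A = sverts B /\
  {in sverts A &, forall x y, sadj B (f x) (f y) = sadj A x y}.

Definition equivariant_iso (G H : sgraph) (s : G -> G) (t : H -> H)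
    (f : G -> H) : Prop :=
  [/\ bijective f, {mono f : x y / adj x y} & forall x, f (s x) = t (f x)].

(* A is determined by the graph G and the self-map s without auxiliary
   choices: it is the value at (G, s) of a construction of subgraphs that
   commutes with all isomorphisms of such pairs. *)
Definition canonical_subgraph (G : sgraph) (s : G -> G) (A : subgraph G) :
    Prop :=
  exists F : forall H : sgraph, (H -> H) -> subgraph H,
    (forall (H K : sgraph) (t : H -> H) (u : K -> K) (f : H -> K),
        equivariant_iso t u f -> maps_onto f (F H t) (F K u))
    /\ F G s = A.

Definition is_intpart (n : nat) (s : seq nat) : bool :=
  [&& sorted geq s, 0 \notin s & sumn s == n].

Record intpart (n : nat) := IntPart { parts :> seq nat; _ : is_intpart n parts }.

HB.instance Definition _ n := [isSub for @parts n].
HB.instance Definition _ n := [Countable of intpart n by <:].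

Definition drop_zeros (s : seq nat) : seq nat := [seq x <- s | 0 < x].

Section IntPartFinite.
Variable n : nat.

Fact size_intpart_le (l : intpart n) : size l <= n.
Proof.
case: l => s /= /and3P[_ + /eqP <-].
elim: s => //= x s IH; rewrite inE negb_or => /andP[x0 /IH].
by case: x x0 => // x _ h; rewrite addSn ltnS (leq_trans h) ?leq_addl.
Qed.

Fact intpart_nth_le (l : intpart n) i : nth 0 l i <= n.
Proof.
case: l => s /= /and3P[_ _ /eqP <-].
elim: s i => [|x s IH] [|i] //=; first exact: leq_addr.
exact: leq_trans (IH i) (leq_addl _ _).
Qed.

Definition intpart_code (l : intpart n) : n.-tuple 'I_n.+1 :=
  [tuple inord (nth 0 l i) | i < n].

Definition intpart_decode (t : n.-tuple 'I_n.+1) : option (intpart n) :=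
  insub (drop_zeros [seq val i | i <- t]).

Fact intpart_codeK : pcancel intpart_code intpart_decode.
Proof.
move=> l; rewrite /intpart_decode.
suff -> : drop_zeros [seq val i | i <- intpart_code l] = l by rewrite valK.
have -> : [seq val i | i <- intpart_code l] = mkseq (nth 0 l) n.
  rewrite /mkseq -val_enum_ord /= -!map_comp; apply: eq_map => i /=.
  by rewrite inordK // ltnS intpart_nth_le.
have := size_intpart_le l; case: l => s /= /and3P[_ s0 _] /subnKC <-.
rewrite /drop_zeros /mkseq iotaD map_cat filter_cat -/(mkseq _ _) mkseq_nth add0n.
rewrite [X in _ ++ X](_ : _ = [::]) ?cats0.
  by apply/all_filterP/allP => x xs; rewrite lt0n; apply: contraNneq s0 => <-.
apply/eqP; rewrite -(negbK (_ == _)) -has_filter; apply/hasPn => x.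
by case/mapP=> i; rewrite mem_iota => /andP[hi _] ->; rewrite nth_default.
Qed.

HB.instance Definition _ : isFinite (intpart n) := PCanIsFinite intpart_codeK.

End IntPartFinite.

Definition conj_seq (s : seq nat) : seq nat :=
  mkseq (fun j => count (fun x => j < x) s) (head 0 s).

Fact conj_seq_subproof n (l : intpart n) : is_intpart n (conj_seq l).
Proof.
case: l => s /= /and3P[sS s0 /eqP sn]; apply/and3P; split.
- apply: (homo_sorted (e := ltn)); last exact: iota_ltn_sorted.
  move=> i j /= ij; apply: sub_count => x /=; exact: ltn_trans.
- apply/negP => /mapP[j]; rewrite mem_iota add0n /=.
  by case: s {sS s0 sn} => //= x s ->.
- rewrite -{}sn; apply/eqP.
  have hle x : x \in s -> x <= head 0 s.
    case: s sS {s0} => //= y s; rewrite path_sortedE; last first.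
      by move=> a b c ba cb; apply: leq_trans cb ba.
    by case/andP=> /allP h _; rewrite inE => /predU1P[->|/h].
  rewrite /conj_seq sumnE big_map -[X in iota 0 X]subn0.
  under eq_bigr do rewrite -sum1_count big_mkcond.
  rewrite exchange_big /= sumnE; apply: eq_big_seq => x /hle xh.
  rewrite (big_cat_nat (n := x)) //= [X in _ + X]big1_seq ?addn0; last first.
    by move=> j; rewrite mem_index_iota /= => /andP[xj _]; rewrite ltnNge xj.
  rewrite (eq_big_nat _ _ (F2 := fun=> 1)) ?sum_nat_const_nat ?subn0 ?muln1 //.
  by move=> j /andP[_ ->].
Qed.

(* Moves one unit from the part of index i to the part of index j; the index
   j = size s refers to a newly adjoined zero part. *)
Definition transfer (s : seq nat) (i j : nat) : seq nat :=
  sort geq (drop_zeros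
    (mkseq (fun k => nth 0 s k - (k == i) + (k == j)) (size s).+1)).

Definition intpart_adj n : rel (intpart n) := fun l m =>
  (l != m) &&
  [exists i : 'I_(size l), [exists j : 'I_(size l).+1,
     (i != j :> nat) && (parts m == transfer l i j)]].

Fact transferP n (l m : intpart n) :
  reflect (exists a b s, perm_eq l (drop_zeros [:: a.+1, b & s]) /\
                         perm_eq m (drop_zeros [:: a, b.+1 & s]))
    [exists i : 'I_(size l), [exists j : 'I_(size l).+1,
       (i != j :> nat) && (parts m == transfer l i j)]].
Proof.
have pos (k : intpart n) : drop_zeros k = k.
  apply/all_filterP/allP => x; case: k => s /= /and3P[_ s0 _] xs.
  by rewrite lt0n; apply: contraNneq s0 => <-.
have srt (k : intpart n) : sorted geq k by case: k => s /= /and3P[].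
have padE : mkseq (nth 0 l) (size l).+1 = rcons l 0.
  by rewrite mkseqS mkseq_nth nth_default.
have nzpad : drop_zeros (rcons l 0) = l by rewrite /drop_zeros filter_rcons /= -/(drop_zeros l) pos.
have split2 (I : seq nat) i j : uniq I -> i \in I -> j \in I -> i != j ->
    exists R, perm_eq I [:: i, j & R].
  move=> uI iI jI ij; exists (rem j (rem i I)).
  apply: perm_trans (perm_to_rem iI) _; rewrite perm_cons.
  by apply: perm_to_rem; rewrite mem_rem_uniq // !inE eq_sym ij.
apply: (iffP existsP) => [[i /existsP[j /andP[ij /eqP Em]]]|].
  have iI : val i \in iota 0 (size l).+1.
    by rewrite mem_iota add0n /= ltnS ltnW.
  have jI : val j \in iota 0 (size l).+1 by rewrite mem_iota add0n /= ltn_ord.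
  have [R PR] := split2 _ _ _ (iota_uniq 0 (size l).+1) iI jI ij.
  have /and3P[iR jR _] : uniq [:: val i, val j & R].
    by rewrite -(perm_uniq PR) iota_uniq.
  have li : 0 < nth 0 l i.
    have : nth 0 l i \in drop_zeros l by rewrite pos mem_nth.
    by rewrite mem_filter => /andP[].
  exists (nth 0 l i).-1, (nth 0 l j), (map (nth 0 l) R); rewrite prednK //; split.
    by rewrite -{1}nzpad -padE; apply/perm_filter/(perm_map (nth 0 l) PR).
  rewrite Em /transfer perm_sort; apply/perm_filter.
  apply: perm_trans (perm_map _ PR) _ => /=.
  rewrite !eqxx (negPf ij) (eq_sym (val j)) (negPf ij) addn0 subn0 addn1 subn1.
  suff -> : [seq nth 0 l k - (k == i) + (k == j) | k <- R] = map (nth 0 l) R by [].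
  apply/eq_in_map => k kR.
  have /negPf-> : k != j by apply: contraNneq jR => /= <-.
  have /negPf-> : k != i.
    by apply: contraNneq iR => /= <-; rewrite inE kR orbT.
  by rewrite subn0 addn0.
case=> a [b [s [Pl Pm]]].
have [s' Ps nzs] : exists2 s', perm_eq [:: a.+1, b & s'] (rcons l 0) & drop_zeros s' = drop_zeros s.
  have nznz : drop_zeros (drop_zeros s) = drop_zeros s by rewrite /drop_zeros filter_id.
  case: b Pl {Pm} => [|b] Pl.
    exists (drop_zeros s) => //; rewrite perm_sym perm_rcons perm_sym.
    by rewrite -(perm_catCA [:: 0] [:: a.+1]) /= perm_cons perm_sym.
  exists (0 :: drop_zeros s) => //; rewrite perm_sym perm_rcons perm_sym.
  by rewrite -(perm_catCA [:: 0] [:: a.+1; b.+1]) /= perm_cons perm_sym.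
have [Is PI EI] := perm_iotaP 0 Ps.
rewrite size_rcons in PI.
case: Is PI EI => [|i [|j R]] PI // [Ea Eb Es].
have /and3P[+ _ _] : uniq [:: i, j & R] by rewrite (perm_uniq PI) iota_uniq.
rewrite inE negb_or => /andP[ij iR].
have /and3P[_ jR _] : uniq [:: i, j & R] by rewrite (perm_uniq PI) iota_uniq.
have nthE k : nth 0 (rcons l 0) k = nth 0 l k.
  rewrite nth_rcons; case: ltngtP => // [h|->]; last by rewrite nth_default.
  by rewrite nth_default // ltnW.
rewrite !nthE in Ea Eb.
have iL : i < size l by rewrite ltnNge; apply/negP => h; rewrite nth_default in Ea.
have jL : j < (size l).+1.
  have : j \in iota 0 (size l).+1 by rewrite -(perm_mem PI) !inE eqxx orbT.
  by rewrite mem_iota.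
exists (Ordinal iL); apply/existsP; exists (Ordinal jL); rewrite /= ij /=.
have geq_tr : transitive geq by move=> x y z yx zy; apply: leq_trans zy yx.
have geq_as : antisymmetric geq.
  by move=> x y /=; rewrite andbC -eqn_leq => /eqP.
have geq_tot : total geq by move=> x y; rewrite /= leq_total.
apply/eqP/(sorted_eq geq_tr geq_as (srt m) (sort_sorted geq_tot _)).
rewrite perm_sym perm_sort perm_sym; apply: perm_trans Pm _; rewrite perm_sym.
have -> : drop_zeros [:: a, b.+1 & s] = drop_zeros [:: a, b.+1 & s'] by rewrite /drop_zeros /= -!/(drop_zeros _) nzs.
apply/perm_filter; rewrite perm_sym in PI.
apply: perm_trans (perm_map _ PI) _ => /=.
rewrite !eqxx (negPf ij) (eq_sym j) (negPf ij) addn0 subn0 addn1 subn1 -Ea -Eb /=.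
rewrite Es.
suff -> : [seq nth 0 l k - (k == i) + (k == j) | k <- R] =
          [seq nth 0 (rcons l 0) k | k <- R] by [].
apply/eq_in_map => k kR; rewrite nthE.
have /negPf-> : k != j by apply: contraNneq jR => <-.
have /negPf-> : k != i by apply: contraNneq iR => <-.
by rewrite subn0 addn0.
Qed.

Fact intpart_adj_sym n : symmetric (@intpart_adj n).
Proof.
suff H (l m : intpart n) : intpart_adj l m -> intpart_adj m l.
  by move=> l m; apply/idP/idP => /H.
case/andP=> lm /transferP[a [b [s [Pl Pm]]]].
rewrite /intpart_adj eq_sym lm /=; apply/transferP; exists b, a, s.
have nzC x y : perm_eq (drop_zeros [:: x, y & s]) (drop_zeros [:: y, x & s]).
  by apply/perm_filter/permEl; exact: (perm_catCA [:: x] [:: y]).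
by split; [apply: perm_trans Pm _ | apply: perm_trans Pl _].
Qed.

Fact intpart_adj_irrefl n : irreflexive (@intpart_adj n).
Proof. by move=> l; rewrite /intpart_adj eqxx. Qed.

Definition partition_graph (n : nat) : sgraph :=
  @SGraph (intpart n) (@intpart_adj n) (@intpart_adj_sym n) (@intpart_adj_irrefl n).

Definition conjugate n (l : partition_graph n) : partition_graph n :=
  IntPart (conj_seq_subproof l).

Definition axis (n : nat) : {set partition_graph n} :=
  [set l | l == conjugate l].

Definition axial (n : nat) : Prop := axis n != set0.

Definition central_region (n r : nat) : {set partition_graph n} :=
  [set l | gdist_set l (axis n) <= r].

Definition thin_spine (n : nat) : subgraph (partition_graph n) :=
  induced (spine_set (axis n)).

(* Main.v *)
(* On conjugate partitions an elementary transfer reads linearly: if the parts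
   [a + 1], [b] of [l] become [a], [b + 1], then the conjugate of [m] is that of
   [l] minus one box in row [a] plus one box in row [b].  Hence conjugation
   preserves adjacency.  If [l] and [m] are moreover self-conjugate, the removed
   and the added boxes both lie on the diagonal, which is impossible because
   the diagonal boxes of a diagram form an initial segment of the diagonal.
   Canonicity holds because the fixed points of an involution, and the spine
   built on them, are transported by every equivariant isomorphism. *)
Require Import Defs.
From mathcomp Require Import all_boot.
From mathcomp Require Import zify.
Set Implicit Arguments.
Unset Strict Implicit.
Unset Printing Implicit Defensive.

(** * Graph distance and membership in the spine *)

Section GraphFacts.
Variable G : sgraph.
Implicit Types (x y : G) (S : {set G}).

Lemma gdist_le_walk k x y : walk k x y -> gdist x y <= k.
Proof.
move=> w; rewrite /gdist leqNgt; apply/negP => kf.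
(* [gdist] never exceeds [#|G|], so a [k] below it lies in the searched range. *)
have kG : k < #|G| by rewrite -(size_iota 0 #|G|) (leq_trans kf) ?find_size.
by have := before_find 0 kf; rewrite nth_iota // add0n w.
Qed.

Lemma gdist_refl x : gdist x x = 0.
Proof.
apply/eqP; rewrite -leqn0; apply: gdist_le_walk.
by apply/existsP; exists [tuple] => /=.
Qed.

Lemma gdist_adj x y : adj x y -> gdist x y <= 1.
Proof.
move=> xy; apply: gdist_le_walk.
by apply/existsP; exists [tuple y]; rewrite /= xy eqxx.
Qed.

Lemma gdist_set_le x y S : y \in S -> gdist_set x S <= gdist x y.
Proof.
move=> yS; rewrite /gdist_set; have := mem_index_enum y.
elim: (index_enum G) => // z r IH; rewrite inE big_cons => /predU1P[<-|/IH rle].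
  by rewrite yS geq_minl.
by case: ifP => // _; apply: leq_trans (geq_minr _ _) rle.
Qed.

(** The vertex [x] itself witnesses that [a] and [b] have a common neighbor, so their adjacency in
    the interaction graph needs no separate clause. *)
Lemma mem_spine_set S x :
  reflect (x \in S \/ exists a b,
             [/\ a \in S, b \in S, a != b, adj a x & adj b x])
          (x \in spine_set S).
Proof.
rewrite inE; apply: (iffP orP) => [] [xS|]; [by left| |by left|].
  case/bigcupP=> -[[a aS] [b bS]] /= /andP[ab _]; rewrite !inE => /andP[ax bx].
  by right; exists a, b.
case=> a [b [aS bS ab ax bx]]; right.
have xM : x \in mediators a b by rewrite !inE ax.
apply/bigcupP; exists (exist _ a aS, exist _ b bS) => //=.
by apply/andP; split=> //; apply/set0Pn; exists x.
Qed.

End GraphFacts.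

(** * Transport of the spine along equivariant isomorphisms *)

Lemma equivariant_iso_sym (H K : sgraph) (t : H -> H) (u : K -> K) f :
  equivariant_iso t u f ->
  exists2 g, cancel f g /\ cancel g f & equivariant_iso u t g.
Proof.
case=> [[g fK gK] fadj ft]; exists g => //; split.
- by exists f.
- by move=> x y; rewrite -fadj !gK.
- by move=> x; apply: (can_inj fK); rewrite ft !gK.
Qed.

Lemma equivariant_iso_spine (H K : sgraph) (t : H -> H) (u : K -> K) f x :
  equivariant_iso t u f -> x \in spine_set [set y | y == t y] ->
  f x \in spine_set [set y | y == u y].
Proof.
case=> [fbij fadj ft]; have finj := bij_inj fbij.
have ffix y : (f y \in [set y | y == u y]) = (y \in [set y | y == t y]).
  by rewrite !inE -ft (inj_eq finj).
case/mem_spine_set => [xS|[a [b [aS bS ab ax bx]]]]; apply/mem_spine_set.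
  by left; rewrite ffix.
by right; exists (f a), (f b); rewrite !ffix !fadj (inj_eq finj).
Qed.

(** The isomorphism gives one inclusion of vertex sets, its inverse the other. *)
Lemma maps_onto_spine (H K : sgraph) (t : H -> H) (u : K -> K) f :
  equivariant_iso t u f ->
  maps_onto f (induced (spine_set [set x | x == t x]))
              (induced (spine_set [set x | x == u x])).
Proof.
move=> fiso; have [g [fK gK] giso] := equivariant_iso_sym fiso; split=> /=.
  apply/setP=> y; apply/imsetP/idP => [[x xS ->]|yS].
    exact: equivariant_iso_spine fiso xS.
  by exists (g y); rewrite ?gK //; apply: equivariant_iso_spine giso yS.
move=> x y xS yS; have [_ fadj _] := fiso.
by rewrite /induced_adj fadj xS yS !(equivariant_iso_spine fiso).
Qed.

(** * Rows and columns of nonincreasing sequences *)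

Lemma sorted_geq_nth s i j : sorted geq s -> i <= j -> nth 0 s j <= nth 0 s i.
Proof.
move=> sS ij; have [js|sj] := ltnP j (size s); last by rewrite (nth_default _ sj).
have geq_tr : transitive geq by move=> x y z yx zy; apply: leq_trans zy yx.
by apply: (sorted_leq_nth geq_tr leqnn 0 sS); rewrite ?inE // (leq_ltn_trans ij).
Qed.

(** The entries exceeding [j] form an initial segment of [s]; past the end, the default 0 exceeds
    nothing. *)
Lemma lt_count_gt s i j :
  sorted geq s -> (i < count (fun x => j < x) s) = (j < nth 0 s i).
Proof.
elim: s i => [|x s IH] i sS; first by rewrite nth_nil.
have /= := sorted_geq_nth sS (leq0n _) => xmax.
have sS' := path_sorted sS.
case: i => [|i] /=.
  case: (ltnP j x) => // xj; apply/negbTE; rewrite -leqNgt leqn0 add0n.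
  rewrite -leqn0 leqNgt (IH 0 sS') -leqNgt.
  exact: leq_trans (xmax 1) xj.
case: (ltnP j x) => xj; first by rewrite add1n ltnS IH.
rewrite add0n (leq_gtF (leq_trans (xmax i.+1) xj)).
apply/negbTE; rewrite -leqNgt; apply: (@leq_trans 0) => //.
rewrite leqNgt (IH 0 sS') -leqNgt; exact: leq_trans (xmax 1) xj.
Qed.

Lemma nth_conj_seq s j :
  sorted geq s -> nth 0 (conj_seq s) j = count (fun x => j < x) s.
Proof.
move=> sS; have [js|sj] := ltnP j (head 0 s); first by rewrite nth_mkseq.
rewrite nth_default ?size_mkseq //; apply/esym/eqP.
by rewrite -leqn0 leqNgt lt_count_gt // nth0 -leqNgt.
Qed.

(** * Conjugation, elementary transfers and the axis *)

Section Partitions.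
Variable n : nat.
Implicit Types l m : partition_graph n.

Lemma intpart_sorted l : sorted geq l.
Proof. by case: l => s /= /and3P[]. Qed.

Lemma intpart_pos l i : i < size l -> 0 < nth 0 l i.
Proof.
case: l => s /= /and3P[_ s0 _] /(mem_nth 0) xs.
by rewrite lt0n; apply: contraNneq s0 => <-.
Qed.

(** Parts are positive, so the default 0 marks the end of the list and the padded rows determine its
    length. *)
Lemma intpart_nth_inj l m : nth 0 l =1 nth 0 m -> l = m.
Proof.
move=> lm; apply: val_inj; apply: (@eq_from_nth _ 0) => [|i _]; last exact: lm.
apply/eqP; rewrite eqn_leq; apply/andP; split; rewrite leqNgt; apply/negP.
  by move/intpart_pos; rewrite lm nth_default.
by move/intpart_pos; rewrite -lm nth_default.
Qed.

(** Both sides say that the diagram of [l] has a box in row [i] and column [j], counted from 0. *)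
Lemma lt_nth_conjugate l i j :
  (i < nth 0 (conjugate l) j) = (j < nth 0 l i).
Proof. by rewrite nth_conj_seq ?lt_count_gt ?intpart_sorted. Qed.

Lemma conjugateK : involutive (@conjugate n).
Proof.
move=> l; apply: intpart_nth_inj => i.
have E k : (k < nth 0 (conjugate (conjugate l)) i) = (k < nth 0 l i).
  by rewrite !lt_nth_conjugate.
by apply/eqP; rewrite eqn_leq leqNgt E ltnn leqNgt -E ltnn.
Qed.

Lemma axis_lt_nthC l i j :
  l \in axis n -> (i < nth 0 l j) = (j < nth 0 l i).
Proof. by rewrite inE => /eqP lE; rewrite {1}lE lt_nth_conjugate. Qed.

Lemma drop_zeros_intpart l k :
  size l <= k -> drop_zeros (mkseq (nth 0 l) k) = l.
Proof.
move=> /subnKC<-; rewrite /mkseq iotaD map_cat add0n -/(mkseq _ _) mkseq_nth.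
rewrite /drop_zeros filter_cat.
have -> : [seq x <- l | 0 < x] = l.
  by apply/all_filterP/(all_nthP 0) => i; apply: intpart_pos.
rewrite (eq_in_filter (a2 := pred0)) ?filter_pred0 ?cats0 // => x /mapP[i].
by rewrite mem_iota => /andP[li _] ->; rewrite nth_default.
Qed.

(** Turning a part [a.+1] into [a] changes the number of parts exceeding [j] only at [j = a];
    turning [b] into [b.+1], only at [j = b]. The additive form avoids truncated subtraction. *)
Lemma adj_nth_conjugate l m : adj l m ->
  exists2 p : nat * nat, p.1 != p.2 & forall j,
    nth 0 (conjugate m) j + (j == p.1) = nth 0 (conjugate l) j + (j == p.2).
Proof.
case/andP=> lm /transferP[a [b [s [Pl Pm]]]].
have E j : nth 0 (conjugate m) j + (j == a) = nth 0 (conjugate l) j + (j == b).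
  have count_drop0 t : count (fun x => j < x) (drop_zeros t)
      = count (fun x => j < x) t.
    rewrite count_filter; apply: eq_count => x /=.
    by case: (ltnP j x) => // /(leq_ltn_trans (leq0n _)) ->.
  rewrite !nth_conj_seq ?intpart_sorted //.
  rewrite (permP Pl) (permP Pm) !count_drop0 /= !ltnS.
  rewrite (leq_eqVlt j a) (leq_eqVlt j b).
  case: eqP => [->|_]; case: eqP => [->|_]; rewrite ?ltnn /=; lia.
(* If [a = b], the conjugates coincide, hence so do [l] and [m]. *)
exists (a, b) => //=; apply: contraNneq lm => ab; subst b.
rewrite -[l]conjugateK -[m]conjugateK; apply/eqP; congr conjugate.
by apply: intpart_nth_inj => j; apply/esym/(addIn (E j)).
Qed.

Lemma adj_nth l m (a b : nat) : a != b ->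
  (forall j, nth 0 m j + (j == a) = nth 0 l j + (j == b)) -> adj l m.
Proof.
move=> ab E.
have Ea : nth 0 l a = (nth 0 m a).+1.
  by have := E a; rewrite eqxx (negPf ab) addn0 addn1.
have Eb : nth 0 m b = (nth 0 l b).+1.
  by have := E b; rewrite eqxx eq_sym (negPf ab) addn0 addn1.
have al : a < size l.
  by rewrite ltnNge; apply/negP => la; rewrite nth_default in Ea.
have m0 k : size l <= k -> k != b -> nth 0 m k = 0.
  move=> lk kb; have := E k; rewrite (negPf kb) (nth_default _ lk) addn0.
  by move/eqP; rewrite addn_eq0 => /andP[/eqP].
(* Otherwise row [size l] of [m] would be empty above the nonempty row [b]. *)
have bl : b < (size l).+1.
  rewrite ltnS leqNgt; apply/negP => lb.
  have := sorted_geq_nth (intpart_sorted m) (ltnW lb).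
  by rewrite Eb (m0 _ (leqnn _)) // neq_ltn lb.
have sm : size m <= (size l).+1.
  rewrite leqNgt; apply/negP => /intpart_pos.
  by rewrite m0 // neq_ltn bl orbT.
apply/andP; split; first by apply/eqP => lm; move: Ea; rewrite lm => /n_Sn.
apply/existsP; exists (Ordinal al); apply/existsP; exists (Ordinal bl) => /=.
(* The rows after the transfer are already those of [m], in order; only padding zeros are
   dropped. *)
rewrite ab /= /transfer (eq_mkseq (g := nth 0 m)); last first.
  move=> k /=; have := E k; case: (k =P a) => [->|_]; first by rewrite Ea; lia.
  by rewrite addn0 subn0.
rewrite drop_zeros_intpart //; apply/eqP/esym/sorted_sort.
  by move=> x y z yx zy; apply: leq_trans zy yx.
exact: intpart_sorted.
Qed.

Lemma conjugate_adj l m : adj (conjugate l) (conjugate m) = adj l m.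
Proof.
suff H l' m' : adj l' m' -> adj (conjugate l') (conjugate m').
  by apply/idP/idP => /H //; rewrite !conjugateK.
by case/adj_nth_conjugate => -[a b]; apply: adj_nth.
Qed.

(* If [m] arises from [l] by removing a box of row [a], the symmetry of both
   diagrams puts that box in column [a] as well. *)
Lemma axis_nth_diag l m a : l \in axis n -> m \in axis n ->
  (forall j, nth 0 m j < nth 0 l j -> j = a) ->
  nth 0 l a = (nth 0 m a).+1 -> nth 0 m a = a.
Proof.
move=> lA mA ltE la; apply: ltE.
have al : a < nth 0 l (nth 0 m a) by rewrite axis_lt_nthC // la.
by apply: leq_ltn_trans al; rewrite leqNgt axis_lt_nthC // ltnn.
Qed.

Lemma edgeless_axis : edgeless (induced (axis n)).
Proof.
move=> l m; apply/negP => /and3P[lA mA /adj_nth_conjugate[[a b] ab E]].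
have [lE mE] : conjugate l = l /\ conjugate m = m.
  by split; apply/esym/eqP; [move: lA|move: mA]; rewrite inE.
rewrite {}lE {}mE /= in ab E.
have Ea : nth 0 l a = (nth 0 m a).+1.
  by have := E a; rewrite eqxx (negPf ab) addn0 addn1.
have Eb : nth 0 m b = (nth 0 l b).+1.
  by have := E b; rewrite eqxx eq_sym (negPf ab) addn0 addn1.
(* Only row [a] shrinks from [l] to [m], and only row [b] from [m] to [l]. *)
have ma : nth 0 m a = a.
  by apply: (axis_nth_diag lA mA) => // j; have := E j; case: eqP => //; lia.
have lb : nth 0 l b = b.
  by apply: (axis_nth_diag mA lA) => // j; have := E j; case: (j =P b) => //; lia.
(* In [m], rows [a] and [b] have lengths [a] and [b.+1]; in [l], [a.+1] and [b]. One of the two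
   fails to be nonincreasing. *)
move: ab; rewrite neq_ltn => /orP[ab|ba].
  by have := sorted_geq_nth (intpart_sorted m) (ltnW ab); lia.
by have := sorted_geq_nth (intpart_sorted l) (ltnW ba); lia.
Qed.

End Partitions.

Theorem theorem5p1 (n : nat) (n_gt0 : 0 < n) (n_axial : axial n) :
  [/\ [/\ involutive (@conjugate n),
          automorphism (@conjugate n)
        & axis n = [set l | conjugate l == l]],
      edgeless (induced (axis n)),
      [/\ is_induced (thin_spine n),
          maps_onto (@conjugate n) (thin_spine n) (thin_spine n)
        & canonical_subgraph (@conjugate n) (thin_spine n)]
    & axis n \subset sverts (thin_spine n)
      /\ sverts (thin_spine n) \subset central_region n 1].
Proof.
have conj_iso : equivariant_iso (@conjugate n) (@conjugate n) (@conjugate n).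
  split=> //; first exact: inv_bij (@conjugateK n).
  exact: conjugate_adj.
split.
- split; first exact: conjugateK.
    by have [] := conj_iso.
  by apply/setP=> l; rewrite !inE eq_sym.
- exact: edgeless_axis.
- split; last 2 first.
  + exact: maps_onto_spine conj_iso.
  (* The axis is a fixed-point set, so the construction makes sense for any graph with a
     self-map. *)
  + exists (fun H t => induced (spine_set [set x | x == t x])); split=> //.
    exact: maps_onto_spine.
  by move=> x y xS yS; rewrite /= /induced_adj xS yS.
split; first exact: subsetUl.
apply/subsetP=> x; rewrite [_ \in central_region _ _]inE.
case/mem_spine_set=> [xA|[a [_ [aA _ _ ax _]]]].
  by apply: leq_trans (gdist_set_le _ xA) _; rewrite gdist_refl.
by apply: leq_trans (gdist_set_le _ aA) _; rewrite gdist_adj // adj_sym.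
Qed.
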